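(* Let $T$ be a tree and let $1 \leq p < \infty$. The backward shift $B$ is bounded on $\mathbb{H}^p(T)$ if and only if the set $$\left\{ \frac{(K(1,n))^{p-1}\, \gamma(n+1)}{\gamma(n)} \, : \, n \in \mathbb{N}_0 \right\}$$ is bounded. In this case, $$\| B \| = \left(\sup \left\{ \frac{(K(1,n))^{p-1}\, \gamma(n+1)}{\gamma(n)} \, : \, n \in \mathbb{N}_0 \right\} \right)^{1/p}.$$
   Context: $\mathbb{N}_0=\{0,1,2,\dots\}$. A tree $T$ means a connected graph with no cycles, with countably infinitely many vertices, locally finite (every vertex has finitely many adjacent vertices), with a distinguished vertex $\mathrm{o}$ called the root. For a vertex $v$, $|v|$ is the number of edges in the unique path between $\mathrm{o}$ and $v$; $v$ is in level $n$ if $|v|=n$, and $\gamma(n)$ is the number of vertices in level $n$. For $v\neq \mathrm{o}$, $\operatorname{par}(v)$ (the parent of $v$) is the unique vertex $w$ on the path from $v$ to $\mathrm{o}$ with $|w|=|v|-1$; $\operatorname{Chi}(v)$ is the set of children of $v$, i.e. of vertices $u$ with $\operatorname{par}(u)=v$ (possibly empty). $\gamma(1,v)$ is the cardinality of $\operatorname{Chi}(v)$, and for $r\in\mathbb{N}_0$, $K(1,r):=\max\{\gamma(1,v): |v|=r\}$. $\mathcal{F}$ is the vector space of all complex-valued functions on the set of vertices of $T$. For $f\in\mathcal{F}$ and $n\in\mathbb{N}_0$, $M_p(n,f):=\left(\frac{1}{\gamma(n)}\sum_{|v|=n}|f(v)|^p\right)^{1/p}$. The Hardy space $\mathbb{H}^p(T)$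 is the set of $f\in\mathcal{F}$ with $\|f\|:=\sup_{n\in\mathbb{N}_0}M_p(n,f)<\infty$; it is a Banach space with this norm. The backward shift $B:\mathcal{F}\to\mathcal{F}$ is the linear map $(Bf)(v)=\sum_{w\in\operatorname{Chi}(v)}f(w)$ (empty sums are $0$). ''$B$ is bounded on $\mathbb{H}^p(T)$'' means that $B$ maps $\mathbb{H}^p(T)$ into itself and is a bounded linear operator there; $\|B\|$ is then its operator norm. *)

(* Defs.v *)
From HB Require Import structures.
From mathcomp Require Import all_boot all_order all_algebra.
From mathcomp Require Import finmap complex.
From mathcomp Require Import all_classical all_reals all_analysis.
Set Implicit Arguments.
Unset Strict Implicit.
Unset Printing Implicit Defensive.
Import Order.TTheory GRing.Theory Num.Theory numFieldNormedType.Exports.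
Local Open Scope classical_set_scope.
Local Open Scope ring_scope.

(* An infinite, locally finite, rooted tree; [countType] together with
   [infinite_vertex] makes the vertex set countably infinite.  The bound
   [2 < size c] is needed because an edge x -- y makes [:: x; y] a [ucycle]. *)
Record tree := Tree {
  vertex :> countType;
  adj : rel vertex;
  root : vertex;
  adj_sym : symmetric adj;
  adj_irr : irreflexive adj;
  adj_connected : forall x y, exists s, path adj x s /\ last x s = y;
  adj_acyclic : forall c : seq vertex, (2 < size c)%N -> ~ ucycle adj c;
  adj_locally_finite : forall x, finite_set [set y | adj x y];
  infinite_vertex : infinite_set [set: vertex] }.

Section TreeCombinatorics.
Variable T : tree.
Implicit Types (u v w : T) (n r : nat).

(* The list of vertices following the root on the unique simple path from the
   root to v; its size is the number of edges of that path. *)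
Definition root_path v : seq T :=
  xget [::] [set s | [/\ path (@adj T) (root T) s, uniq (root T :: s)
                       & last (root T) s = v]].

Definition level v : nat := size (root_path v).

Definition level_set n : set T := [set v | level v = n].

(* Junk value: the parent of the root is the root. *)
Definition parent v : T :=
  xget (root T) [set w | w \in root T :: root_path v
                         /\ (level w).+1 = level v].

Definition children v : set T := [set u | u <> root T /\ parent u = v].

Definition gamma n : nat := #|` fset_set (level_set n)|.

Definition gamma1 v : nat := #|` fset_set (children v)|.

Definition K1 r : nat := \big[maxn/0%N]_(v \in level_set r) gamma1 v.

End TreeCombinatorics.

Arguments level_set : clear implicits.

Section Hardy.
Variables (R : realType) (T : tree).
Implicit Types (p : R) (f g : T -> R[i]) (A : (T -> R[i]) -> T -> R[i]).

Definition Mp p n f : R :=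
  ((gamma T n)%:R^-1
     * \sum_(v \in level_set T n) (ComplexField.Normc.normc (f v)) `^ p) `^ p^-1.

Definition hardy_norm p f : \bar R :=
  ereal_sup (range (fun n => (Mp p n f)%:E)).

Definition hardy p : set (T -> R[i]) := [set f | (hardy_norm p f < +oo)%E].

Definition bounded_on_hardy p A : Prop :=
  [/\ forall f, hardy p f -> hardy p (A f),
      forall (a : R[i]) f g, hardy p f -> hardy p g ->
        A (fun v => a * f v + g v) = (fun v => a * A f v + A g v)
    & exists C : R, forall f, hardy p f ->
        (hardy_norm p (A f) <= C%:E * hardy_norm p f)%E].

Definition hardy_opnorm p A : \bar R :=
  ereal_sup [set hardy_norm p (A f) | f in
               [set f | hardy p f /\ (hardy_norm p f <= 1)%E]].

Definition backward_shift f : T -> R[i] :=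
  fun v => \sum_(w \in children v) f w.

Definition shift_ratios p : set R :=
  range (fun n => (K1 T n)%:R `^ (p - 1)
                  * (gamma T n.+1)%:R / (gamma T n)%:R).

End Hardy.

(* Main.v *)
Require Import Defs.
From mathcomp Require Import all_boot all_order all_algebra.
From mathcomp Require Import finmap complex.
From mathcomp Require Import all_classical all_reals all_analysis.
From mathcomp Require Import ring.
Set Implicit Arguments.
Unset Strict Implicit.
Unset Printing Implicit Defensive.
Import Order.TTheory GRing.Theory Num.Theory numFieldNormedType.Exports.
Local Open Scope classical_set_scope.
Local Open Scope ring_scope.

(** Let r_n = K(1,n)^(p-1) gamma(n+1) / gamma(n).  Both halves of the theorem
    come from comparing M_p(n, B f) with M_p(n+1, f), level by level.

    Upper bound.  The power mean inequality [powR_sum_le] bounds |B f(v)|^p, for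
    v in level n, by gamma(1,v)^(p-1) <= K(1,n)^(p-1) times the sum of |f|^p over
    the children of v.  The sets of children of the vertices of level n partition
    level n+1 ([sum_level_succ]), so summing over v gives
    M_p(n, B f) <= r_n^(1/p) M_p(n+1, f) ([Mp_backward_shift_le]).

    Lower bound.  Choose v0 in level n with gamma(1,v0) = K(1,n) and let f be
    constant on the children of v0 and 0 elsewhere, the constant being such that
    M_p(n+1, f) = 1.  Then f has norm 1, and the vertex v0 alone makes
    M_p(n, B f) at least r_n^(1/p) ([exists_extremal]).

    So B is bounded exactly when the r_n are, and then ||B||^p is their supremum.

    The facts about trees behind this rest on the uniqueness of simple paths in
    an acyclic graph ([simple_path_unique]): it makes every prefix of the path
    from the root to v the path from the root to its own endpoint, so that the
    parent of v lies exactly one level below v.  It follows that level n+1 splits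
    according to parents, and that no level is empty, since beyond an empty level
    all levels would be empty and the tree would be finite. *)

(** * Levels, parents and children in a tree *)

Section Tree.
Variable T : tree.
Local Notation o := (Defs.root T).
Implicit Types (u v w x y : T) (n r : nat) (s t : seq T).

(** Two simple paths with the same endpoints coincide. After removal of the
    common first vertices, the first path up to the point y where it first meets
    the second one, followed by the second one backwards from y, would be a
    cycle. *)
Lemma simple_path_unique x s t :
  path (@adj T) x s -> uniq (x :: s) -> path (@adj T) x t -> uniq (x :: t) ->
  last x s = last x t -> s = t.
Proof.
elim: s x t => [|a s IHs] x [|b t].
- by [].
- move=> _ _ _ /andP[xt _] /= xlast.
  by rewrite xlast mem_last in xt.
- move=> _ /andP[xs _] _ _ /= xlast.
  by rewrite -xlast mem_last in xs.
have [<- /= /andP[_ ps] /andP[_ us] /andP[_ pt] /andP[_ ut] e|ab] := eqVneq a b.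
  by rewrite (IHs a t).
set s' := a :: s; set t' := b :: t => ps us pt ut lst.
have hs : has [in t'] s'.
  apply/hasP; exists (last x s'); first exact: (mem_last a s).
  by rewrite lst; exact: (mem_last b t).
case: {-2}s' _ _ / (split_find hs) (erefl s') => y s1 s2 yt s1t /esym s'E.
have [t1 [t2 t'E]] : exists t1 t2, t' = t1 ++ y :: t2.
  by case/splitPr: yt => t1 t2; exists t1, t2.
have cyc : cycle (@adj T) (x :: s1 ++ y :: rev t1).
  rewrite /= -cat_rcons rcons_cat cat_path last_rcons; apply/andP; split.
    by move: ps; rewrite s'E cat_path => /andP[].
  have : path (@adj T) x (rcons t1 y).
    by move: pt; rewrite t'E -cat_rcons cat_path => /andP[].
  rewrite -rev_path last_rcons belast_rcons rev_cons.
  by rewrite (@eq_path _ _ (@adj T)) // => ? ?; rewrite adj_sym.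
have ucyc : uniq (x :: s1 ++ y :: rev t1).
  move: us ut; rewrite s'E t'E /= !mem_cat !mem_rcons !cat_uniq !inE rcons_uniq.
  rewrite mem_rev /= rev_uniq !negb_or.
  move=> /andP[/andP[/andP[-> ->] _]] /andP[/andP[-> ->] _].
  move=> /andP[/andP[-> _]] /andP[-> /andP[/andP[yt1 _] _]].
  rewrite mem_rev yt1 !andbT /=; apply: contra s1t => /hasP[z /=].
  rewrite mem_rev => zt1 zs1; apply/hasP; exists z => //=.
  by rewrite t'E mem_cat zt1.
(* The cycle has at least three vertices because the paths leave x through
   distinct neighbours a and b, so that s1 and t1 are not both empty. *)
exfalso; apply: (@adj_acyclic T (x :: s1 ++ y :: rev t1)); last first.
  by apply/andP; split.
case: s1 s'E {s1t cyc ucyc} => [|? s1] //= s'E; last first.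
  by rewrite size_cat /= size_rev !addnS.
case: t1 t'E => [|? t1] //= t'E; last by rewrite size_rev.
by case: s'E t'E => ya _ [yb _]; rewrite ya yb eqxx in ab.
Qed.

Lemma root_pathP v : [/\ path (@adj T) o (root_path v),
  uniq (o :: root_path v) & last o (root_path v) = v].
Proof.
suff : exists s,
    [/\ path (@adj T) o s, uniq (o :: s) & last o s = v].
  by move=> /(xgetPex [::]).
have [s [ps <-]] := adj_connected o v.
by case: (shortenP ps) => s' ps' us' _; exists s'.
Qed.

Lemma root_path_eq s : path (@adj T) o s -> uniq (o :: s) ->
  root_path (last o s) = s.
Proof.
move=> ps us; have [pr ur lr] := root_pathP (last o s).
exact: (@simple_path_unique o).
Qed.

Lemma level_root : level o = 0%N.
Proof. by rewrite /level (@root_path_eq [::]). Qed.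

Lemma level_parent v : v <> o -> (level (parent v)).+1 = level v.
Proof.
move=> vr; suff : exists w, w \in o :: root_path v /\ (level w).+1 = level v.
  by move=> /(xgetPex o)[].
have [] := root_pathP v; rewrite /level.
case/lastP: (root_path v) => [_ _ /esym //|s z].
rewrite rcons_path size_rcons -rcons_cons rcons_uniq.
move=> /andP[ps _] /andP[_ us] _; exists (last o s); split.
  by rewrite mem_rcons in_cons mem_last orbT.
by rewrite root_path_eq.
Qed.

Lemma level_child v u : children v u -> level u = (level v).+1.
Proof. by case=> ur <-; rewrite level_parent. Qed.

Lemma children_level v u n : level v = n ->
  children v u <-> level u = n.+1 /\ parent u = v.
Proof.
move=> <-; split => [vu|[lu pu]]; first by split; [exact: level_child|case: vu].
by split => // ur; rewrite ur level_root in lu.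
Qed.

Lemma finite_level n : finite_set (level_set T n).
Proof.
(* Paths of length n from the root need not be simple here: their endpoints are
   already finitely many by local finiteness. *)
apply: (@sub_finite_set _ _ [set v | exists s,
    [/\ path (@adj T) o s, size s = n & last o s = v]]).
  by move=> v <-; exists (root_path v); case: (root_pathP v).
elim: n => [|n IHn].
  apply: (@sub_finite_set _ _ [set o]); last exact: finite_set1.
  by move=> v [s [_ /size0nil -> <-]].
apply: sub_finite_set (bigcup_finite IHn (fun x _ => @adj_locally_finite T x)).
move=> v [s []]; case/lastP: s => [//|s z].
rewrite rcons_path size_rcons last_rcons => /andP[ps sz] [sn] <-.
by exists (last o s) => //; exists s.
Qed.

Lemma finite_children v : finite_set (children v).
Proof.
apply: sub_finite_set (finite_level (level v).+1) => u.
exact: level_child.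
Qed.

(** Beyond an empty level every level is empty, and the tree would be finite. *)
Lemma level_neq0 n : level_set T n !=set0.
Proof.
apply/set0P/eqP => Ln0.
have Lge m : (n <= m)%N -> level_set T m = set0.
  elim: m => [|m IHm]; first by rewrite leqn0 => /eqP <-.
  rewrite leq_eqVlt ltnS => /predU1P[<- //|/IHm Lm0].
  apply/seteqP; split => // v lv.
  suff : level_set T m (parent v) by rewrite Lm0.
  apply: succn_inj; rewrite level_parent // => vr.
  by rewrite vr /level_set/= level_root in lv.
apply: (@infinite_vertex T).
apply: sub_finite_set (bigcup_finite (finite_II n) (fun m _ => finite_level m)).
move=> v _; exists (level v) => //=; rewrite ltnNge; apply/negP => /Lge.
by move/seteqP => -[/(_ v)] /(_ erefl).
Qed.

Lemma gamma_gt0 n : (0 < gamma T n)%N.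
Proof.
rewrite /gamma lt0n cardfs_eq0; apply/eqP => /(fset_set_set0 (finite_level n)).
by move=> L0; have := level_neq0 n; rewrite L0 => -[].
Qed.

(** Level n+1 is the disjoint union of the sets of children of the vertices of
    level n. *)
Lemma sum_level_succ (V : nmodType) n (F : T -> V) :
  \sum_(u <- fset_set (level_set T n.+1)) F u =
  \sum_(v <- fset_set (level_set T n)) \sum_(u <- fset_set (children v)) F u.
Proof.
pose L m := fset_set (level_set T m).
have LE m v : (v \in L m) = (level v == m).
  rewrite in_fset_set; last exact: finite_level.
  by apply/idP/eqP => [/set_mem|?]; last exact: mem_set.
transitivity (\sum_(v <- L n) \sum_(u <- L n.+1 | parent u == v) F u).
  rewrite (exchange_big_dep xpredT) //= !big_seq; apply: eq_bigr => u.
  rewrite LE => /eqP lu; rewrite -big_filter.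
  rewrite (_ : [seq v <- L n | parent u == v] = [:: parent u]) ?big_seq1 //.
  apply: perm_small_eq => //; apply: uniq_perm => //.
    by rewrite filter_uniq // fset_uniq.
  move=> v; rewrite mem_filter inE LE (eq_sym v); case: eqP => //= <-.
  apply/eqP/succn_inj; rewrite level_parent //.
  by move=> ur; rewrite ur level_root in lu.
rewrite !big_seq; apply: eq_bigr => v; rewrite LE => /eqP lv.
rewrite -big_filter; apply: perm_big; apply: uniq_perm.
- by rewrite filter_uniq // fset_uniq.
- exact: fset_uniq.
move=> u; rewrite mem_filter LE in_fset_set; last exact: finite_children.
apply/idP/idP => [/andP[/eqP pu /eqP lu]|/set_mem /(@children_level _ _ _ lv)[-> ->]].
  by apply/mem_set/(@children_level _ _ _ lv).
by rewrite !eqxx.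
Qed.

Lemma sum_gamma1 n :
  (\sum_(v <- fset_set (level_set T n)) gamma1 v)%N = gamma T n.+1.
Proof.
rewrite /gamma cardfE -sum1_card.
rewrite -(big_seq_fsetE addn (fset_set (level_set T n.+1)) xpredT (fun=> 1%N)) /=.
rewrite (sum_level_succ (V := nat) n (fun=> 1%N)).
by apply: eq_bigr => v _; rewrite sum1_size.
Qed.

Lemma gamma1_le_K1 n v : level v = n -> (gamma1 v <= K1 T n)%N.
Proof.
move=> lv; rewrite /K1 fsbig_finite; last exact: finite_level.
apply: leq_bigmax_seq => //; rewrite in_fset_set; last exact: finite_level.
exact: mem_set.
Qed.

Lemma K1_attained n : exists2 v : T, level v = n & gamma1 v = K1 T n.
Proof.
have [v0 lv0] := level_neq0 n.
have : forall r : seq T, exists2 v, v \in v0 :: r &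
    (\max_(w <- r) gamma1 w <= gamma1 v)%N.
  elim=> [|w r [v vr IH]]; first by exists v0; rewrite ?inE ?big_nil.
  rewrite big_cons; have [wv|vw] := leqP (gamma1 w) (gamma1 v).
    exists v; last by rewrite geq_max wv.
    by move: vr; rewrite !inE => /orP[->|->]; rewrite ?orbT.
  exists w; first by rewrite !inE eqxx orbT.
  by rewrite geq_max leqnn (leq_trans IH) // ltnW.
move=> /(_ (fset_set (level_set T n)))[v vL Kv].
have lv : level v = n.
  move: vL; rewrite inE in_fset_set; last exact: finite_level.
  by move=> /predU1P[-> //|/set_mem].
exists v => //; apply/eqP; rewrite eqn_leq gamma1_le_K1 //=.
by rewrite /K1 fsbig_finite; last exact: finite_level.
Qed.

(** If no vertex of level n had a child, level n+1 would be empty. *)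
Lemma K1_gt0 n : (0 < K1 T n)%N.
Proof.
rewrite lt0n; apply/eqP => K0; have := gamma_gt0 n.+1.
rewrite -sum_gamma1 big_seq big1 // => v.
rewrite in_fset_set; last exact: finite_level.
by move=> /set_mem/gamma1_le_K1; rewrite K0 leqn0 => /eqP.
Qed.

End Tree.

(** * The power mean inequality and moduli of complex numbers *)

Section PowerSums.
Variable R : realType.
Implicit Types (p a b : R).

(** Convexity of x |-> x^p at the points (n+1) a and ((n+1)/n) b with weights
    1/(n+1) and n/(n+1), whose barycentre is a + b. *)
Lemma powRD_le_weighted p (n : nat) a b : 1 <= p -> (0 < n)%N -> 0 <= a -> 0 <= b ->
  (a + b) `^ p <= n.+1%:R `^ (p - 1) * (a `^ p + b `^ p / n%:R `^ (p - 1)).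
Proof.
move=> p1 n0 a0 b0; have p0 : 0 < p by exact: lt_le_trans p1.
have N0 : 0 < n%:R :> R by rewrite ltr0n.
have M0 : 0 < n.+1%:R :> R by rewrite ltr0n.
have t0 : 0 <= n.+1%:R^-1 :> R by rewrite invr_ge0 ltW.
have t1 : n.+1%:R^-1 <= 1 :> R by rewrite invf_le1 // ler1n.
have := @convex_powR R p p1 (Itv01 t0 t1) (n.+1%:R * a) (n.+1%:R / n%:R * b).
rewrite !inE /= !in_itv /= !andbT => /(_ _)/(_ _).
rewrite !mulr_ge0 ?divr_ge0 ?(ltW N0) ?(ltW M0) // => /(_ isT isT) ineq.
rewrite convRE [X in X `^ _ <= _]convRE /= /unstable.onem in ineq.
move: ineq.
have -> : 1 - n.+1%:R^-1 = n%:R / n.+1%:R :> R.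
  by rewrite -natr1; field; rewrite natr1 lt0r_neq0.
rewrite mulKf ?lt0r_neq0 //.
have -> : n%:R / n.+1%:R * (n.+1%:R / n%:R * b) = b.
  by rewrite mulrA mulrA mulfVK ?lt0r_neq0 // mulfV ?lt0r_neq0 // mul1r.
move=> /le_trans; apply.
rewrite !powRM ?divr_ge0 ?(ltW N0) ?(ltW M0) ?invr_ge0 //.
have -> : n%:R^-1 `^ p = (n%:R `^ p)^-1 :> R.
  by rewrite -powR_inv1 ?(ltW N0) // -powRrM mulN1r powRN.
rewrite -(mulr_powRB1 (ltW M0) p0) -(mulr_powRB1 (ltW N0) p0).
rewrite le_eqVlt; apply/orP; left; apply/eqP; field.
by rewrite !lt0r_neq0 ?powR_gt0.
Qed.

(** The power mean inequality, by induction on the number of terms. *)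
Lemma powR_sum_le p (I : Type) (s : seq I) (F : I -> R) : 1 <= p ->
  (forall i, 0 <= F i) ->
  (\sum_(i <- s) F i) `^ p <= (size s)%:R `^ (p - 1) * \sum_(i <- s) F i `^ p.
Proof.
move=> p1 F0; have p0 : 0 < p by exact: lt_le_trans p1.
elim: s => [|i [|j s] IHs].
- by rewrite !big_nil mulr0 powR0 // gt_eqF.
- by rewrite !big_seq1 powR1 mul1r.
rewrite big_cons [in leRHS]big_cons; set S := \sum_(k <- _) _.
apply: le_trans (powRD_le_weighted (n := size (j :: s)) _ _ _ _) _ => //.
  by rewrite sumr_ge0.
rewrite ler_wpM2l ?powR_ge0 // lerD2l ler_pdivrMr ?powR_gt0 ?ltr0n //.
by rewrite mulrC.
Qed.

Lemma powRVK p a : 1 <= p -> 0 <= a -> (a `^ p^-1) `^ p = a.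
Proof.
move=> p1 a0; rewrite -powRrM mulVf ?powRr1 // gt_eqF //.
exact: lt_le_trans p1.
Qed.

Lemma powRKV p a : 1 <= p -> 0 <= a -> (a `^ p) `^ p^-1 = a.
Proof.
move=> p1 a0; rewrite -powRrM mulfV ?powRr1 // gt_eqF //.
exact: lt_le_trans p1.
Qed.

Lemma normc_ge0 (z : R[i]) : 0 <= ComplexField.Normc.normc z.
Proof. by case: z => x y; rewrite /ComplexField.Normc.normc sqrtr_ge0. Qed.

Lemma normc_real a : 0 <= a -> ComplexField.Normc.normc (a%:C)%C = a.
Proof.
by move=> a0; rewrite /ComplexField.Normc.normc /= expr0n /= addr0 sqrtr_sqr ger0_norm.
Qed.

Lemma normc_sum_le (I : Type) (s : seq I) (F : I -> R[i]) :
  ComplexField.Normc.normc (\sum_(i <- s) F i) <=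
  \sum_(i <- s) ComplexField.Normc.normc (F i).
Proof.
elim: s => [|i s IHs]; first by rewrite !big_nil ComplexField.Normc.normc0.
by rewrite !big_cons (le_trans (le_normcD _ _)) // lerD2l.
Qed.

End PowerSums.

(** * The backward shift on the Hardy space *)

Section Hardy.
Variables (R : realType) (T : tree) (p : R).
Hypothesis p1 : 1 <= p.
Implicit Types (f g : T -> R[i]) (n : nat) (C : R).
Local Notation normc := ComplexField.Normc.normc.
Local Notation B := (@backward_shift R T).

(** The number r_n = K(1,n)^(p-1) gamma(n+1) / gamma(n); [shift_ratios T p] is
    the range of this sequence. *)
Definition shift_ratio n : R :=
  (K1 T n)%:R `^ (p - 1) * (gamma T n.+1)%:R / (gamma T n)%:R.

Let p0 : 0 < p. Proof. exact: lt_le_trans p1. Qed.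
Let p_ge0 : 0 <= p. Proof. exact: ltW. Qed.
Let pV0 : 0 <= p^-1. Proof. by rewrite invr_ge0 ltW. Qed.
Let gamma0 n : 0 < (gamma T n)%:R :> R. Proof. by rewrite ltr0n gamma_gt0. Qed.

Lemma shift_ratio_ge0 n : 0 <= shift_ratio n.
Proof. by rewrite /shift_ratio divr_ge0 ?mulr_ge0 ?powR_ge0. Qed.

Lemma backward_shiftE f v : B f v = \sum_(w <- fset_set (children v)) f w.
Proof. by rewrite /backward_shift fsbig_finite //; exact: finite_children. Qed.

Lemma MpE n f : Mp p n f =
  ((gamma T n)%:R^-1 * \sum_(v <- fset_set (level_set T n)) normc (f v) `^ p)
    `^ p^-1.
Proof. by rewrite /Mp fsbig_finite //; exact: finite_level. Qed.

Lemma Mp_ge0 n f : 0 <= Mp p n f. Proof. exact: powR_ge0. Qed.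

Lemma hardy_normP C f :
  (hardy_norm p f <= C%:E)%E <-> forall n, Mp p n f <= C.
Proof.
split=> [fC n|fC].
  by rewrite -lee_fin; apply: le_trans fC; apply: ereal_sup_ubound; exists n.
by apply: ge_ereal_sup => _ [n _ <-]; rewrite lee_fin.
Qed.

Lemma Mp_le_hardy_norm n f : ((Mp p n f)%:E <= hardy_norm p f)%E.
Proof. by apply: ereal_sup_ubound; exists n. Qed.

(** On the Hardy space the extended real norm is a nonnegative real number. *)
Lemma hardy_normE f : hardy p f ->
  exists2 C, 0 <= C & hardy_norm p f = C%:E.
Proof.
rewrite /hardy /=; have := Mp_le_hardy_norm 0 f.
case: (hardy_norm p f) => [C| |] //.
by rewrite lee_fin => /(le_trans (Mp_ge0 _ _)) C0 _; exists C.
Qed.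

Lemma Mp_backward_shift_le n f :
  Mp p n (B f) <= shift_ratio n `^ p^-1 * Mp p n.+1 f.
Proof.
have S0 m h : 0 <= \sum_(v <- fset_set (level_set T m)) normc (h v) `^ p.
  by rewrite sumr_ge0 // => v _; exact: powR_ge0.
rewrite !MpE -powRM ?shift_ratio_ge0 ?mulr_ge0 ?invr_ge0 ?S0 //.
rewrite ge0_ler_powR ?nnegrE ?mulr_ge0 ?shift_ratio_ge0 ?invr_ge0 ?S0 //.
(* The factors gamma(n+1) cancel. *)
have -> S : shift_ratio n * ((gamma T n.+1)%:R^-1 * S) =
    (gamma T n)%:R^-1 * ((K1 T n)%:R `^ (p - 1) * S).
  by rewrite /shift_ratio; field; rewrite !lt0r_neq0.
rewrite ler_wpM2l ?invr_ge0 ?(ltW (gamma0 _)) // sum_level_succ mulr_sumr.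
rewrite big_seq [leRHS]big_seq; apply: ler_sum => v.
rewrite in_fset_set; last exact: finite_level.
move=> /set_mem lv; rewrite backward_shiftE.
apply: (@le_trans _ _ ((\sum_(w <- fset_set (children v)) normc (f w)) `^ p)).
  rewrite ge0_ler_powR ?p_ge0 ?nnegrE ?normc_ge0 ?normc_sum_le //.
  by rewrite sumr_ge0 // => w _; exact: normc_ge0.
apply: le_trans (powR_sum_le _ _ _) _ => // [w|]; first exact: normc_ge0.
rewrite ler_wpM2r //; first by rewrite sumr_ge0 // => w _; exact: powR_ge0.
rewrite ge0_ler_powR ?subr_ge0 ?nnegrE ?ler0n // ler_nat.
exact: gamma1_le_K1.
Qed.

(** The test function is a constant c on the children of a vertex v0 with
    K(1,n) children, and 0 elsewhere. *)
Lemma exists_extremal n : exists2 f, (hardy_norm p f <= 1)%E &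
  shift_ratio n `^ p^-1 <= Mp p n (B f).
Proof.
have [v0 lv0 Kv0] := K1_attained T n.
set Ch := fset_set (children v0).
have K0 : 0 < (K1 T n)%:R :> R by rewrite ltr0n K1_gt0.
(* This value of c gives K(1,n) c^p = gamma(n+1), that is, M_p(n+1, f) = 1. *)
pose c : R := ((gamma T n.+1)%:R / (K1 T n)%:R) `^ p^-1.
have c0 : 0 <= c by exact: powR_ge0.
have cp : c `^ p = (gamma T n.+1)%:R / (K1 T n)%:R.
  by rewrite powRVK // divr_ge0.
pose f u : R[i] := if u \in Ch then (c%:C)%C else 0.
exists f.
  apply/hardy_normP => m; rewrite MpE -[leRHS](_ : 1 `^ p^-1 = 1); last by rewrite powR1.
  rewrite ge0_ler_powR ?nnegrE ?mulr_ge0 ?invr_ge0 ?sumr_ge0 //.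
    by move=> v _; exact: powR_ge0.
  rewrite ler_pdivrMl ?gamma0 // mulr1.
  rewrite (eq_bigr (fun u => if u \in Ch then c `^ p else 0)); last first.
    move=> u _; rewrite /f; case: ifP => _; first by rewrite normc_real.
    by rewrite ComplexField.Normc.normc0 powR0 // gt_eqF.
  rewrite -big_mkcond /=; have [->|mn] := eqVneq m n.+1; last first.
    rewrite big_seq_cond big1 ?(ltW (gamma0 _)) // => u.
    rewrite !in_fset_set; [|exact: finite_children|exact: finite_level].
    move=> /andP[/set_mem lu /set_mem/level_child].
    by rewrite lv0 lu => /eqP; rewrite (negbTE mn).
  rewrite -big_filter (perm_big Ch) /=; last first.
    apply: uniq_perm; rewrite ?filter_uniq ?fset_uniq // => u.
    rewrite mem_filter andb_idr // !in_fset_set;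
      [|exact: finite_level|exact: finite_children].
    by move=> /set_mem/level_child lu; rewrite mem_set // /level_set /= lu lv0.
  rewrite big_const_seq count_predT iter_addr_0 -[size _]/(gamma1 v0) Kv0 cp.
  by rewrite -[leLHS]mulr_natr divfK // lt0r_neq0.
rewrite MpE ge0_ler_powR ?nnegrE ?shift_ratio_ge0 ?mulr_ge0 ?invr_ge0 ?sumr_ge0 //.
  by move=> v _; exact: powR_ge0.
(* Only the term of the sum at v0 is kept. *)
rewrite (big_fsetD1 v0) /=; last first.
  by rewrite in_fset_set ?mem_set //; exact: finite_level.
have -> : B f v0 = ((gamma1 v0)%:R * c)%:C%C.
  rewrite backward_shiftE big_seq (eq_bigr (fun=> c%:C%C)) => [|u uC]; last first.
    by rewrite /f uC.
  by rewrite -big_seq big_const_seq count_predT iter_addr_0 mulr_natl rmorphMn.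
rewrite normc_real ?mulr_ge0 // powRM // cp Kv0 /shift_ratio.
rewrite -(mulr_powRB1 (ltW K0) p0) mulrDr -[leLHS]addr0 lerD //.
  rewrite le_eqVlt; apply/orP; left; apply/eqP; field.
  by rewrite !lt0r_neq0.
by rewrite mulr_ge0 ?invr_ge0 ?sumr_ge0 // => v _; exact: powR_ge0.
Qed.

Lemma hardy_norm_backward_shift_le C f : (forall n, shift_ratio n <= C) ->
  hardy p f -> (hardy_norm p (B f) <= (C `^ p^-1)%:E * hardy_norm p f)%E.
Proof.
move=> rC /hardy_normE[N N0 fN]; rewrite fN -EFinM; apply/hardy_normP => n.
apply: le_trans (Mp_backward_shift_le n f) _.
apply: ler_pM; rewrite ?powR_ge0 ?Mp_ge0 //.
  by rewrite ge0_ler_powR ?nnegrE ?(le_trans _ (rC n)) ?shift_ratio_ge0.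
by rewrite -lee_fin -fN Mp_le_hardy_norm.
Qed.

Lemma bounded_shift_ratiosP :
  bounded_set (shift_ratios T p) <-> exists C, forall n, shift_ratio n <= C.
Proof.
split=> [[M [_ hM]]|[C hC]].
  exists (M + 1) => n; have /(_ (M + 1)) := hM; rewrite ltrDl ltr01.
  move=> /(_ isT (shift_ratio n)); rewrite /= ger0_norm ?shift_ratio_ge0 //.
  by apply; exists n.
exists C; split; first exact: num_real.
move=> x Cx _ [n _ <-]; rewrite /= ger0_norm; last exact: shift_ratio_ge0.
exact: le_trans (hC n) (ltW Cx).
Qed.

Lemma backward_shift_linear (a : R[i]) f g :
  B (fun v => a * f v + g v) = (fun v => a * B f v + B g v).
Proof.
apply/funext => v; rewrite !backward_shiftE mulr_sumr -big_split.
by [].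
Qed.

Lemma backward_shift_bounded C : (forall n, shift_ratio n <= C) ->
  bounded_on_hardy p B.
Proof.
move=> rC; split.
- move=> f hf; apply: le_lt_trans (hardy_norm_backward_shift_le rC hf) _.
  by have [N _ ->] := hardy_normE hf; rewrite -EFinM ltry.
- by move=> a f g _ _; exact: backward_shift_linear.
- by exists (C `^ p^-1) => f; exact: hardy_norm_backward_shift_le.
Qed.

Lemma shift_ratio_bounded : bounded_on_hardy p B ->
  exists C, forall n, shift_ratio n <= C.
Proof.
move=> [_ _ [C hC]]; exists (C `^ p) => n.
have [f f1 rf] := exists_extremal n.
have hf : hardy p f by apply: le_lt_trans f1 _; rewrite ltry.
have [N N0 fN] := hardy_normE hf.
move: f1 (hC f hf); rewrite fN -EFinM lee_fin => N1 /hardy_normP/(_ n) CN.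
have rCN := le_trans rf CN.
rewrite -(powRVK p1 (shift_ratio_ge0 n)).
(* The bound C is not assumed to be nonnegative; a negative one would force
   r_n = 0. *)
have [C0|C0] := lerP 0 C; last first.
  have r0 : shift_ratio n `^ p^-1 <= 0.
    by rewrite (le_trans rCN) // mulr_le0_ge0 // ltW.
  have -> : shift_ratio n `^ p^-1 = 0 by apply/le_anti; rewrite r0 powR_ge0.
  by rewrite powR0 ?powR_ge0 // gt_eqF.
rewrite ge0_ler_powR ?nnegrE ?powR_ge0 ?p_ge0 //.
by rewrite (le_trans rCN) // ler_piMr.
Qed.

Lemma hardy_opnorm_backward_shift : bounded_on_hardy p B ->
  hardy_opnorm p B = ((sup (shift_ratios T p)) `^ p^-1)%:E.
Proof.
move=> /shift_ratio_bounded[C hC].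
have ratios_ub : has_ubound (shift_ratios T p).
  by exists C => _ [n _ <-]; exact: hC.
have ratio_le_sup n : shift_ratio n <= sup (shift_ratios T p).
  by apply: ub_le_sup => //; exists n.
have opnorm_le : (hardy_opnorm p B <= ((sup (shift_ratios T p)) `^ p^-1)%:E)%E.
  apply: ge_ereal_sup => _ [f [hf f1] <-].
  apply: le_trans (hardy_norm_backward_shift_le ratio_le_sup hf) _.
  by rewrite -[leRHS]mule1 lee_wpmul2l // lee_fin powR_ge0.
have ratio_le_opnorm n : ((shift_ratio n `^ p^-1)%:E <= hardy_opnorm p B)%E.
  have [f f1 rf] := exists_extremal n.
  apply: (@le_trans _ _ (hardy_norm p (B f))).
    by apply: le_trans (Mp_le_hardy_norm n _); rewrite lee_fin.
  apply: ereal_sup_ubound; exists f => //; split => //.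
  by apply: le_lt_trans f1 _; rewrite ltry.
apply/le_anti; rewrite opnorm_le /=.
move: opnorm_le ratio_le_opnorm (ratio_le_opnorm 0%N).
case: (hardy_opnorm p B) => [y| |] //; rewrite !lee_fin => _ ry r0y.
have y0 : 0 <= y by exact: le_trans (powR_ge0 _ _) r0y.
rewrite -(powRKV p1 y0) ge0_ler_powR ?nnegrE ?powR_ge0 //.
  exact: le_trans (shift_ratio_ge0 0) (ratio_le_sup 0%N).
apply: ge_sup; first by exists (shift_ratio 0); exists 0%N.
move=> _ [n _ <-]; rewrite -[leLHS](powRVK p1 (shift_ratio_ge0 n)).
by rewrite ge0_ler_powR ?nnegrE ?powR_ge0 ?p_ge0 // -lee_fin.
Qed.

End Hardy.

Theorem theorem4p1p1 (R : realType) (T : tree) (p : R) (hp : 1 <= p) :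
  (bounded_on_hardy p (@backward_shift R T) <->
   bounded_set (shift_ratios T p)) /\
  (bounded_on_hardy p (@backward_shift R T) ->
   hardy_opnorm p (@backward_shift R T) =
     ((sup (shift_ratios T p)) `^ p^-1)%:E).
Proof.
split; last exact: hardy_opnorm_backward_shift.
split=> [/(shift_ratio_bounded hp)/bounded_shift_ratiosP //|].
by move=> /bounded_shift_ratiosP[C]; exact: backward_shift_bounded.
Qed.
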